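(* Let $S$, $C$ and $L$ be the sufficiency, conditionality and likelihood relations on the set $\mathcal{I}$ of inference bases, and let $\bar{C}$ be the equivalence relation generated by $C$. Then $S\cup C\subset\bar{C}=L$, where the first containment is proper. Furthermore, $S\subset\bar{C}$ and this containment is proper.
   Context: A relation on a set $D$ is a subset $R\subset D\times D$; $\bar{R}$ denotes the equivalence relation generated by $R$, i.e. the smallest equivalence relation on $D$ containing $R$. $\mathcal{I}$ is the set of all inference bases $I=(E,x)$, where $E=(\mathcal{X}_E,\{f_{E,\theta}:\theta\in\Theta_E\})$ is a model, $\mathcal{X}_E$ is a sample space, $\{f_{E,\theta}:\theta\in\Theta_E\}$ is a collection of probability density functions on $\mathcal{X}_E$ with respect to some support measure $\mu_E$ on $\mathcal{X}_E$, and $x\in\mathcal{X}_E$ is the observed data. Measure-theoretic considerations are ignored, and in general the discussion can be considered restricted to the case where $\mathcal{X}_E$ and $\Theta_E$ are finite, with $\mu_E$ counting measure. Write $I_i=(E_i,x_i)$. Likelihood relation $L$: $(I_1,I_2)\in L$ whenever $\Theta_{E_1}=\Theta_{E_2}$ and there exists $c>0$ such that $f_{E_1,\theta}(x_1)=c f_{E_2,\theta}(x_2)$ for every $\theta$. A statistic on $E$ is a function on $\mathcal{X}_E$. It is sufficient for $E$ if the conditional distribution of the data given its value does not depend on $\theta$, and minimal sufficient if it is sufficient and is a function of every sufficient statistic. The marginal model induced by a statistic $m$ is the family, indexed by $\theta\in\Theta_E$, of distributions of $m$ under $f_{E,\theta}$. Sufficiency relation $S$: $(I_1,I_2)\in S$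 whenever $\Theta_{E_1}=\Theta_{E_2}$ and there exist minimal sufficient statistics $m_1$ for $E_1$ and $m_2$ for $E_2$ such that the marginal models induced by the $m_i$ are the same and $m_1(x_1)=m_2(x_2)$. A statistic $a$ is ancillary for $E$ if its distribution under $f_{E,\theta}$ is the same for all $\theta\in\Theta_E$. The conditional model given $a(x_0)$ is the model, with parameter set $\Theta_E$, consisting of the conditional distributions of the data under each $f_{E,\theta}$ given that $a$ takes the value $a(x_0)$. Conditionality relation $C$: $(I_1,I_2)\in C$ whenever $\Theta_{E_1}=\Theta_{E_2}$, $x_1=x_2$ and there exists an ancillary statistic $a$ for $E_1$ such that the conditional model given $a(x_1)$ is given by $E_2$, or with the roles of $I_1$ and $I_2$ reversed.
   Formalization: Observed data must have positive density for some parameter (else S is not inside L); in C, ''x1 = x2'' and ''given by E2'' are read up to a bijective relabelling of the sample space (else C-bar = L fails); models are finite; minimal sufficiency ignores outcomes null under every parameter. *)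

(* Defs.v *)
From Stdlib Require Import Relation_Definitions Relation_Operators.
From mathcomp Require Import all_boot all_order all_algebra.
From mathcomp Require Import reals.
Set Implicit Arguments.
Unset Strict Implicit.
Unset Printing Implicit Defensive.

Import Order.TTheory GRing.Theory Num.Theory.
Local Open Scope ring_scope.

Definition proper_inclusion (D : Type) (P Q : relation D) : Prop :=
  inclusion D P Q /\ ~ inclusion D Q P.

Record model (R : realType) := Model {
  sample : finType;
  param : finType;
  pdf : param -> sample -> R;
  pdf_ge0 : forall th x, 0 <= pdf th x;
  pdf_sum1 : forall th, \sum_x pdf th x = 1 }.

Arguments pdf {R} m _ _.

Definition possible (R : realType) (E : model R) (x : sample E) : Prop :=
  exists th, 0 < pdf E th x.

(* The density is taken with respect to counting measure, so data x with zero
   density under every parameter could never have been observed; such x are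
   excluded, since otherwise sufficiency_rel would not be contained in
   likelihood_rel: when all the densities coincide, a constant statistic is
   minimal sufficient and would identify x with data of positive density.  Models may have null outcomes. *)
Record inference_base (R : realType) := InferenceBase {
  ib_model :> model R;
  obs : sample ib_model;
  obs_possible : possible obs }.

Arguments obs {R} i.

Definition cast_param (T1 T2 : finType) (e : T1 = T2) : T1 -> T2 :=
  match e in _ = T return T1 -> T with erefl => id end.

Definition marginal (R : realType) (E : model R) (T : eqType)
    (m : sample E -> T) (th : param E) (t : T) : R :=
  \sum_(x | m x == t) pdf E th x.

(* Meaningful only when marginal m th t != 0. *)
Definition cond_pdf (R : realType) (E : model R) (T : eqType)
    (m : sample E -> T) (t : T) (th : param E) (x : sample E) : R :=
  if m x == t then pdf E th x / marginal m th t else 0.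

Definition sufficient (R : realType) (E : model R) (T : eqType)
    (m : sample E -> T) : Prop :=
  forall t th1 th2, marginal m th1 t != 0 -> marginal m th2 t != 0 ->
  forall x, cond_pdf m t th1 x = cond_pdf m t th2 x.

(* "Is a function of" is up to outcomes that are null under every parameter:
   a sufficient statistic is unconstrained on those, so that with an exact
   identity no minimal sufficient statistic would exist in general.  If the
   model has no such outcome this is exact functional dependence. *)
Definition minimal_sufficient (R : realType) (E : model R) (T : eqType)
    (m : sample E -> T) : Prop :=
  sufficient m /\
  forall (U : eqType) (s : sample E -> U), sufficient s ->
    exists h : U -> T, forall x, possible x -> m x = h (s x).

Definition ancillary (R : realType) (E : model R) (T : eqType)
    (a : sample E -> T) : Prop :=
  forall th1 th2 t, marginal a th1 t = marginal a th2 t.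

Definition likelihood_rel (R : realType) : relation (inference_base R) :=
  fun I1 I2 => exists e : param I1 = param I2, exists2 c : R, 0 < c &
    forall th, pdf I1 th (obs I1) = c * pdf I2 (cast_param e th) (obs I2).

Definition sufficiency_rel (R : realType) : relation (inference_base R) :=
  fun I1 I2 => exists (e : param I1 = param I2) (T : eqType)
    (m1 : sample I1 -> T) (m2 : sample I2 -> T),
    [/\ minimal_sufficient m1, minimal_sufficient m2,
        forall th t, marginal m1 th t = marginal m2 (cast_param e th) t
      & m1 (obs I1) = m2 (obs I2)].

(* I2 is obtained from I1 by conditioning on the observed value of a.  The
   conditional model lives on the fibre of a through the observed data.  Sample
   spaces are taken up to relabelling: phi identifies the fibre with the sample
   space of I2, and "x1 = x2" is that phi carries the data of I1 to that of I2.
   With x1 = x2 as a literal equality of labels, the generated equivalence would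
   never change the label of the data, and so could not be all of
   likelihood_rel.
   The conditioning event has positive probability by obs_possible and
   ancillarity. *)
Definition conditioned (R : realType) (I1 I2 : inference_base R) : Prop :=
  exists (e : param I1 = param I2) (T : eqType) (a : sample I1 -> T)
    (phi : {x : sample I1 | a x == a (obs I1)} -> sample I2),
    [/\ ancillary a, bijective phi,
        forall th x, pdf I2 (cast_param e th) (phi x) =
                     cond_pdf a (a (obs I1)) th (val x)
      & phi (exist _ (obs I1) (eqxx _)) = obs I2].

Definition conditionality_rel (R : realType) : relation (inference_base R) :=
  fun I1 I2 => conditioned I1 I2 \/ conditioned I2 I1.

(* Main.v *)
Require Import Defs.
From Stdlib Require Import Relation_Definitions Relation_Operators.
From mathcomp Require Import all_boot all_order all_algebra.
From mathcomp Require Import reals.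
From mathcomp Require Import ring lra.

(** Conditioning on an ancillary divides the density of the observed data by
    the probability of the observed value of the ancillary, which is a positive
    constant, the same for every parameter; so it rescales the likelihood
    ([conditioned_likelihood]).  A sufficient statistic likewise leaves a factor
    free of the parameter ([sufficient_factorization]).  Hence C and S lie in L,
    and L, being an equivalence relation, contains the one generated by C.

    For the converse, let the likelihoods of x1 in E1 and of x2 in E2 satisfy
    f1 = c f2, and mix the two models with weights w = 1 / (1 + c) and 1 - w.
    These weights make the points x1 and x2 of the mixture equiprobable under
    every parameter: w f1(x1) = (1 - w) f2(x2).  So the mixture, observed at x1,
    contains a scaled copy of E1, namely its first component, and also a scaled
    copy of E2, namely its second component with x1 taking the place of x2.  The
    indicator of a scaled copy is ancillary ([conditioned_of_embedding]), so
    both inference bases arise from the mixture by conditioning: two steps of C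
    join any two L-related inference bases.

    For properness, compare a success observed in a single trial with success
    probability p, and one observed in a trial with success probability p / 2.  The
    likelihoods are proportional.  If p is not constant, a sufficient statistic
    of such a trial must separate its two outcomes, so that its marginal model
    reveals the success probability, and the pair is not in S.  Nor is it in C:
    both sample spaces have two points, so conditioning one model into the other
    would discard nothing and preserve the density of the data. *)

Set Implicit Arguments.
Unset Strict Implicit.
Unset Printing Implicit Defensive.

Import Order.TTheory GRing.Theory Num.Theory.
Local Open Scope ring_scope.

(** * Likelihood as an equivalence relation *)

Lemma cast_param_sym (T1 T2 : finType) (e : T1 = T2) (th : T2) :
  cast_param e (cast_param (esym e) th) = th.
Proof. by case: _ / e th. Qed.

Lemma cast_param_trans (T1 T2 T3 : finType) (e : T1 = T2) (e' : T2 = T3) th :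
  cast_param (etrans e e') th = cast_param e' (cast_param e th).
Proof. by case: _ / e'; case: _ / e th. Qed.

Lemma likelihood_refl (R : realType) (I : inference_base R) :
  likelihood_rel I I.
Proof. by exists erefl, 1 => // th; rewrite mul1r. Qed.

Lemma likelihood_sym (R : realType) (I1 I2 : inference_base R) :
  likelihood_rel I1 I2 -> likelihood_rel I2 I1.
Proof.
move=> [e [c c_gt0 prop]]; exists (esym e), c^-1; first by rewrite invr_gt0.
by move=> th; rewrite prop cast_param_sym mulKf ?gt_eqF.
Qed.

Lemma likelihood_trans (R : realType) (I1 I2 I3 : inference_base R) :
  likelihood_rel I1 I2 -> likelihood_rel I2 I3 -> likelihood_rel I1 I3.
Proof.
move=> [e [c c_gt0 prop]] [e' [c' c'_gt0 prop']].
exists (etrans e e'), (c * c'); first exact: mulr_gt0.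
by move=> th; rewrite prop prop' cast_param_trans mulrA.
Qed.

(** * Conditionality and sufficiency preserve the likelihood *)

Lemma marginal_ge_pdf (R : realType) (E : model R) (T : eqType)
    (m : sample E -> T) th x :
  pdf E th x <= marginal m th (m x).
Proof.
rewrite /marginal (bigD1 x) //= lerDl.
by apply: sumr_ge0 => y _; apply: pdf_ge0.
Qed.

Lemma conditioned_likelihood (R : realType) (I1 I2 : inference_base R) :
  conditioned I1 I2 -> likelihood_rel I1 I2.
Proof.
move=> [e [T [a [phi [anc _ pdf2 phi_obs]]]]].
have [th0 pos0] := obs_possible I1.
have w_gt0 : 0 < marginal a th0 (a (obs I1)).
  exact: lt_le_trans (marginal_ge_pdf _ _ _).
exists e, (marginal a th0 (a (obs I1))) => // th.
rewrite -phi_obs pdf2 /cond_pdf /= eqxx (anc th th0).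
by rewrite mulrC divfK ?gt_eqF.
Qed.

(** The constant is the conditional probability of [x] given [m x], computed
    under a parameter that makes [x] possible; a parameter under which the value
    [m x] is null makes both sides vanish. *)
Lemma sufficient_factorization (R : realType) (E : model R) (T : eqType)
    (m : sample E -> T) x :
  sufficient m -> possible x ->
  exists2 k : R, 0 < k & forall th, pdf E th x = k * marginal m th (m x).
Proof.
move=> suff [th0 pos0].
have m0_gt0 := lt_le_trans pos0 (marginal_ge_pdf m th0 x).
exists (cond_pdf m (m x) th0 x); first by rewrite /cond_pdf eqxx divr_gt0.
move=> th; have [mth0|mth_neq0] := eqVneq (marginal m th (m x)) 0.
  rewrite mth0 mulr0; apply/le_anti.
  by rewrite pdf_ge0 andbT -mth0 marginal_ge_pdf.
rewrite (suff _ _ _ (lt0r_neq0 m0_gt0) mth_neq0).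
by rewrite /cond_pdf eqxx divfK.
Qed.

Lemma sufficiency_likelihood (R : realType) (I1 I2 : inference_base R) :
  sufficiency_rel I1 I2 -> likelihood_rel I1 I2.
Proof.
move=> [e [T [m1 [m2 [[suff1 _] [suff2 _] same_marginal same_value]]]]].
have [k1 k1_gt0 fact1] := sufficient_factorization suff1 (obs_possible I1).
have [k2 k2_gt0 fact2] := sufficient_factorization suff2 (obs_possible I2).
exists e, (k1 / k2); first exact: divr_gt0.
move=> th; rewrite fact1 fact2 same_marginal same_value.
by rewrite mulrA divfK ?gt_eqF.
Qed.

(** * Proportional likelihoods are joined by conditioning a mixture *)

(** The total mass of a copy of [I2] scaled by [w] is [w] whatever the
    parameter, so the indicator of the copy is ancillary, and conditioning on it
    undoes the scaling. *)
Lemma conditioned_of_embedding (R : realType) (I1 I2 : inference_base R)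
    (e : param I1 = param I2) (w : R) (g : sample I2 -> sample I1) :
  w != 0 -> injective g -> g (obs I2) = obs I1 ->
  (forall th y, pdf I1 th (g y) = w * pdf I2 (cast_param e th) y) ->
  conditioned I1 I2.
Proof.
move=> w_neq0 g_inj g_obs scaled.
pose a (s : sample I1) := s \in codom g.
have a_obs : a (obs I1) = true by rewrite /a -g_obs codom_f.
have a_true th : marginal a th true = w.
  rewrite /marginal (eq_bigl (mem (codom g))) => [|s]; last by rewrite eqb_id.
  rewrite -big_uniq; last exact/injectiveP.
  rewrite /codom big_image /=.
  under eq_bigr do rewrite scaled.
  by rewrite -big_distrr /= pdf_sum1 mulr1.
have a_false th : marginal a th false = 1 - w.
  rewrite -(pdf_sum1 th) (bigID a) /= -(a_true th) addrAC /marginal.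
  rewrite [X in _ - X](eq_bigl a) => [|s]; last by rewrite eqb_id.
  by rewrite subrr add0r; apply: eq_bigl => s; rewrite eqbF_neg.
have a_w th : marginal a th (a (obs I1)) = w by rewrite a_obs.
have fibre (u : {s | a s == a (obs I1)}) : val u \in codom g.
  by case: u => s /=; rewrite a_obs eqb_id.
have fibre_g y : a (g y) == a (obs I1) by rewrite a_obs /a codom_f.
pose phi u := iinv (fibre u).
have phiK u : g (phi u) = val u by apply: f_iinv.
exists e, bool, a, phi; split.
- by move=> th1 th2 []; rewrite ?a_true ?a_false.
- exists (fun y => exist _ (g y) (fibre_g y)) => [u|y].
    by apply: val_inj; rewrite /= phiK.
  by apply: g_inj; rewrite phiK.
- move=> th u; rewrite /cond_pdf (valP u) a_w -phiK scaled.
  by rewrite mulrC mulKf.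
- by apply: g_inj; rewrite phiK g_obs.
Qed.

Section Mixture.

Variables (R : realType) (E1 E2 : model R) (e : param E1 = param E2).
Variables (w : R) (w01 : 0 <= w <= 1).

Let mixture_pdf (th : param E1) (s : sample E1 + sample E2) : R :=
  match s with
  | inl x => w * pdf E1 th x
  | inr y => (1 - w) * pdf E2 (cast_param e th) y
  end.

Fact mixture_ge0 th s : 0 <= mixture_pdf th s.
Proof.
have /andP[w_ge0 w_le1] := w01.
by case: s => [x|y] /=; rewrite mulr_ge0 ?pdf_ge0 ?subr_ge0.
Qed.

Fact mixture_sum1 th : \sum_s mixture_pdf th s = 1.
Proof. by rewrite big_sumType /= -!big_distrr /= !pdf_sum1 !mulr1 subrKC. Qed.

Definition mixture := Model mixture_ge0 mixture_sum1.

End Mixture.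

Lemma likelihood_two_steps (R : realType) (I1 I2 : inference_base R) :
  likelihood_rel I1 I2 ->
  exists2 J : inference_base R, conditioned J I1 & conditioned J I2.
Proof.
move=> [e [c c_gt0 prop]].
pose w := (1 + c)^-1.
have c1_gt0 : 0 < 1 + c by lra.
have w_gt0 : 0 < w by rewrite invr_gt0.
have w'E : 1 - w = w * c.
  by rewrite /w; field; rewrite gt_eqF.
have w'_gt0 : 0 < 1 - w by rewrite w'E mulr_gt0.
have w01 : 0 <= w <= 1 by lra.
pose M := mixture e w01.
have obs_pos : @possible _ M (inl (obs I1)).
  by have [th pos] := obs_possible I1; exists th; apply: mulr_gt0.
pose J := InferenceBase obs_pos.
exists J.
  apply: (@conditioned_of_embedding _ J I1 erefl w inl) => //.
    by rewrite gt_eqF.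
  by move=> x x' [].
(* The copy of I2 borrows the point of the other component for its data. *)
pose g y : sample M := if y == obs I2 then inl (obs I1) else inr y.
apply: (@conditioned_of_embedding _ J I2 e (1 - w) g).
- by rewrite gt_eqF.
- move=> y y'; rewrite /g.
  by case: eqVneq => [->|_]; case: eqVneq => [->|_] // [].
- by rewrite /g eqxx.
- move=> th y; rewrite /g; case: eqVneq => [->|_] //=.
  by rewrite prop w'E mulrA.
Qed.

Lemma conditionality_closure (R : realType) :
  same_relation (inference_base R)
    (clos_refl_sym_trans _ (@conditionality_rel R)) (@likelihood_rel R).
Proof.
split=> I1 I2.
  elim=> {I1 I2} [I1 I2 [|]|I|I1 I2 _|I1 I2 I3 _ L12 _].
  - exact: conditioned_likelihood.
  - by move/conditioned_likelihood/likelihood_sym.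
  - exact: likelihood_refl.
  - exact: likelihood_sym.
  - exact: likelihood_trans.
move/likelihood_two_steps=> [J J1 J2].
by apply: (rst_trans _ _ _ J); apply: rst_step; [right | left].
Qed.

(** * Single trials with proportional success probabilities *)

(** Conditioning keeps only a fibre of the sample space, so when it does not
    shrink the sample space the ancillary is constant. *)
Lemma conditioned_eq_card (R : realType) (I1 I2 : inference_base R) :
  conditioned I1 I2 -> #|sample I1| = #|sample I2| ->
  exists e : param I1 = param I2,
    forall th, pdf I2 (cast_param e th) (obs I2) = pdf I1 th (obs I1).
Proof.
move=> [e [T [a [phi [_ phi_bij pdf2 phi_obs]]]]] eq_card.
exists e => th; rewrite -phi_obs pdf2 /cond_pdf /= eqxx.
have a_const x : a x == a (obs I1).
  have : [pred x | a x == a (obs I1)] =i sample I1.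
    apply/subset_cardP; last exact: subset_predT.
    by rewrite -card_sig (bij_eq_card phi_bij) -eq_card.
  by move/(_ x); rewrite !inE.
have -> : marginal a th (a (obs I1)) = 1.
  by rewrite -(pdf_sum1 th); apply: eq_bigl => x; rewrite a_const.
by rewrite divr1.
Qed.

Section Bernoulli.

Variables (R : realType) (T : finType) (p : T -> R).
Hypothesis p01 : forall th, 0 <= p th <= 1.

Let bernoulli_pdf (th : T) (x : bool) : R := if x then p th else 1 - p th.

Fact bernoulli_ge0 th x : 0 <= bernoulli_pdf th x.
Proof.
by have /andP[p_ge0 p_le1] := p01 th; case: x; rewrite //= subr_ge0.
Qed.

Fact bernoulli_sum1 th : \sum_x bernoulli_pdf th x = 1.
Proof. by rewrite big_bool /= subrKC. Qed.

Definition bernoulli := Model bernoulli_ge0 bernoulli_sum1.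

(** A statistic that merges the two outcomes is constant, hence sufficient only
    if the success probability does not depend on the parameter. *)
Lemma bernoulli_sufficient_marginal (U : eqType) (m : sample bernoulli -> U)
    th1 th2 :
  p th1 != p th2 -> sufficient m ->
  forall th : param bernoulli, marginal m th (m true) = p th.
Proof.
move=> p_neq suff th.
have [m_eq|m_neq] := eqVneq (m false) (m true); last first.
  by rewrite /marginal big_mkcond big_bool /= eqxx (negPf m_neq) addr0.
have marg1 th' : @marginal _ bernoulli _ m th' (m true) = 1.
  by rewrite -(@pdf_sum1 _ bernoulli th'); apply: eq_bigl => -[]; rewrite ?m_eq eqxx.
have := @suff (m true) th1 th2; rewrite !marg1 oner_eq0 => /(_ isT isT true).
by rewrite /cond_pdf eqxx !marg1 !divr1 /= => p_eq; rewrite p_eq eqxx in p_neq.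
Qed.

End Bernoulli.

(** The values of [p] are chosen so that neither [p th = p th' / 2] nor
    [p th / 2 = p th'] is solvable in [th'] for every [th]; this excludes the
    pair from both relations however the parameter sets are identified. *)
Lemma likelihood_not_sufficiency_or_conditionality (R : realType) :
  exists I1 I2 : inference_base R,
    likelihood_rel I1 I2 /\
    ~ union _ (@sufficiency_rel R) (@conditionality_rel R) I1 I2.
Proof.
pose p (th : bool) : R := if th then 1 else 2^-1.
pose q (th : bool) : R := p th / 2.
have p01 th : 0 <= p th <= 1 by rewrite /p; case: th; lra.
have q01 th : 0 <= q th <= 1 by rewrite /q /p; case: th; lra.
have p_pos : @possible _ (bernoulli p01) true by exists true; rewrite /= /p; lra.
have q_pos : @possible _ (bernoulli q01) true by exists true; rewrite /= /q /p; lra.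
exists (InferenceBase p_pos), (InferenceBase q_pos); split.
  exists erefl, 2; first by lra.
  by move=> th; rewrite /= /q; lra.
have p_neq : p true != p false by apply/eqP; rewrite /p; lra.
have q_neq : q true != q false by apply/eqP; rewrite /q /p; lra.
have p_neq_q th : q th <> p true by rewrite /q /p; case: th; lra.
have q_neq_p th : p th <> q false by rewrite /q /p; case: th; lra.
case=> [[e [T [m1 [m2 [[suff1 _] [suff2 _] same_marginal same_value]]]]]|[C12|C21]].
- apply: (p_neq_q (cast_param e true)).
  rewrite -(bernoulli_sufficient_marginal p_neq suff1).
  rewrite same_marginal; move: same_value => /= ->.
  by rewrite (bernoulli_sufficient_marginal q_neq suff2).
- have [e same] := conditioned_eq_card C12 erefl.
  exact: p_neq_q (same true).
- have [e same] := conditioned_eq_card C21 erefl.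
  exact: q_neq_p (same false).
Qed.

Theorem corollary9 (R : realType) :
  let I := inference_base R in
  let S := @sufficiency_rel R in
  let C := @conditionality_rel R in
  let L := @likelihood_rel R in
  let Cbar := clos_refl_sym_trans I C in
  [/\ proper_inclusion (union I S C) Cbar,
      same_relation I Cbar L
    & proper_inclusion S Cbar].
Proof.
move=> I S C L Cbar.
have [CbarL LCbar] := conditionality_closure R.
have SCbar : inclusion I S Cbar.
  by move=> I1 I2 /sufficiency_likelihood /LCbar.
have [I1 [I2 [L12 notSC]]] := likelihood_not_sufficiency_or_conditionality R.
split; [split | exact: conditionality_closure | split => //].
- by move=> J1 J2 [/SCbar | CJ] //; apply: rst_step.
- by move/(_ I1 I2 (LCbar _ _ L12)).
- by move/(_ I1 I2 (LCbar _ _ L12)) => S12; apply: notSC; left.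
Qed.
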